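(* Let $j\ge\tfrac12$ be an integer or half-integer, let $\rho$ be a density operator on $\mathbb C^{2j+1}$, and let $s,t\in\mathbb R$ with $s\ne-1$, $t\neq1$ be such that $$is[\sqrt\rho,J_x]+\{\sqrt\rho,\,J_y-\operatorname{tr}(\rho J_y)\}=0,\qquad it[\sqrt\rho,J_y]+\{\sqrt\rho,\,J_x-\operatorname{tr}(\rho J_x)\}=0 .$$ Put $u=4\operatorname{tr}(\rho J_y)$, $v=4\operatorname{tr}(\rho J_x)$, $s'=\frac{s-1}{s+1}$, $v'=\frac{v}{1-t}$, and let $\widehat T(\xi,\eta)$ be the Wick symbol of $T=\sqrt\rho$. (1) If $s=-t$ and $u=v=0$, then $\widehat T(\xi,\eta)=c\,(\bar\xi\eta+s')^{2j}$ for some constant $c$. (2) If $st=-1$ and $u=0$, then for $s'\ne0$ there is a constant $c$ with $$\widehat T(\xi,\eta)=c\,(\bar\xi+\sqrt{s'})^{j+\frac{v'}{4\sqrt{s'}}}(\bar\xi-\sqrt{s'})^{j-\frac{v'}{4\sqrt{s'}}}(\eta+\sqrt{s'})^{j+\frac{v'}{4\sqrt{s'}}}(\eta-\sqrt{s'})^{j-\frac{v'}{4\sqrt{s'}}},$$ the right-hand side being a polynomial in $\bar\xi,\eta$ (so that $\frac{v'}{4\sqrt{s'}}$ is an integer or a half-integer, consistently with $j$); and for $s'=0$, $\widehat T(\xi,\eta)=c\,\bar\xi^{2j}\eta^{2j}$ for some constant $c$.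
   Context: Spin-$j$ system: $J_x,J_y,J_z$ are the Hermitian generators of the irreducible $(2j+1)$-dimensional representation of $\mathfrak{su}(2)$ on $\mathbb C^{2j+1}$, with $[J_x,J_y]=iJ_z$, $[J_y,J_z]=iJ_x$, $[J_z,J_x]=iJ_y$, and $J_\pm=J_x\pm iJ_y$. The Dicke states $|j,m\rangle$, $m=-j,\dots,j$, are the orthonormal basis with $J_z|j,m\rangle=m|j,m\rangle$, $J_+|j,m\rangle=\sqrt{(j-m)(j+m+1)}\,|j,m+1\rangle$, $J_-|j,m\rangle=\sqrt{(j+m)(j-m+1)}\,|j,m-1\rangle$. $[X,Y]=XY-YX$, $\{X,Y\}=XY+YX$; scalars in operator expressions stand for multiples of the identity; $\sqrt\rho$ is the positive semidefinite square root. For $\xi\in\mathbb C$ the unnormalized coherent state is $\|\xi\rangle=\sum_{m=-j}^j\sqrt{\binom{2j}{j+m}}\,\xi^{j+m}|j,m\rangle$, and the Wick symbol of an operator $T$ is $\widehat T(\xi,\eta)=\langle\xi\|T\|\eta\rangle$, a polynomial in $\bar\xi$ and $\eta$ of degree at most $2j$ in each. For $s'<0$, $\sqrt{s'}$ denotes a fixed complex square root. *)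

(* Defs.v *)
From mathcomp Require Import all_boot all_order all_algebra.
From mathcomp Require Import reals complex.

Set Implicit Arguments.
Unset Strict Implicit.
Unset Printing Implicit Defensive.

Import Order.TTheory GRing.Theory Num.Theory.
Local Open Scope ring_scope.
Local Open Scope sesquilinear_scope.

(* Throughout, n = 2j is a natural number, and matrices act on column vectors  *)
(* in C^(2j+1) written in the Dicke basis: the index k : 'I_n.+1 stands for    *)
(* |j,m> with m = k - j, i.e. j + m = k.                                       *)

Section Spin.
Variables (R : realType) (n : nat).
Local Notation C := R[i].
Local Notation M := 'M[C]_n.+1.

Definition spin : C := n%:R / 2.

Definition mag (k : 'I_n.+1) : C := k%:R - spin.

(* Entry (a, b) is <j,mag a| J |j,mag b>. *)
Definition Jplus : M :=
  \matrix_(a, b) if (a == b.+1 :> nat)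
    then sqrtC ((spin - mag b) * (spin + mag b + 1)) else 0.

Definition Jminus : M :=
  \matrix_(a, b) if (a.+1 == b :> nat)
    then sqrtC ((spin + mag b) * (spin - mag b + 1)) else 0.

(* Solving Jplus = Jx + i Jy and Jminus = Jx - i Jy. *)
Definition Jx : M := 2^-1 *: (Jplus + Jminus).

Definition Jy : M := (2 * 'i)^-1 *: (Jplus - Jminus).

Definition commutator (X Y : M) : M := X *m Y - Y *m X.

Definition anticommutator (X Y : M) : M := X *m Y + Y *m X.

Definition psdmx (A : M) : Prop :=
  A^t* = A /\ forall x : 'cV[C]_n.+1, 0 <= (x^t* *m A *m x) 0 0.

Definition density (rho : M) : Prop := psdmx rho /\ \tr rho = 1.

(* T is the positive semidefinite square root of rho (it is unique). *)
Definition is_psd_sqrt (rho T : M) : Prop := psdmx T /\ T *m T = rho.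

(* Unnormalized coherent state ||xi>. *)
Definition coherent (xi : C) : 'cV[C]_n.+1 :=
  \col_k (sqrtC ('C(n, k))%:R * xi ^+ k).

Definition wick (T : M) (xi eta : C) : C :=
  ((coherent xi)^t* *m T *m coherent eta) 0 0.

End Spin.

Arguments spin R n : clear implicits.
Arguments Jplus R n : clear implicits.
Arguments Jminus R n : clear implicits.
Arguments Jx R n : clear implicits.
Arguments Jy R n : clear implicits.

(* Main.v *)
Require Import Defs.
From mathcomp Require Import all_boot all_order all_algebra.
From mathcomp Require Import reals complex.
From mathcomp Require Import ring.

Import Order.TTheory GRing.Theory Num.Theory.
Local Open Scope ring_scope.

(** Up to nonzero factors the two conditions are linear relations between the
    four products J+ T, J- T, T J+ and T J-.  If st = -1 and u = 0, they say
    that every column of T, and every column of its transpose, is an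
    eigenvector of J+ + s' J- with eigenvalue v'/2.  On the polynomial
    sum_k sqrt(C(n,k)) x_k X^k attached to a vector x, J- acts as d/dX and J+
    as n X - X^2 d/dX, so such an eigenvector p solves
    (s' - X^2) p' = (v'/2 - n X) p; comparing multiplicities at the roots of
    s' - X^2 determines p up to a scalar.  Hence the Wick symbol is F(conj xi)
    times a function of eta, and F(eta) times a function of conj xi, so it is
    c F(conj xi) F(eta).  If s = -t and u = v = 0, the conditions become
    J+ T = s' T J+ and T J- = s' J- T, which force T to be diagonal with
    geometric entries. *)

(** * Polynomial solutions of the first-order equations *)

Section LinearODE.
Variable F : numFieldType.
Implicit Types (p q : {poly F}) (r lam : F).

(** The extra factor ['X - r%:P] avoids the exponent [m - 1], so [m = 0] is no exception. *)
Lemma mul_XsubC_deriv_exp r m :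
  ('X - r%:P) * (('X - r%:P) ^+ m)^`() = m%:R *: ('X - r%:P) ^+ m.
Proof.
rewrite deriv_exp derivXsubC mul1r; case: m => [|m].
  by rewrite mulr0n mulr0 scale0r.
by rewrite mulrnAr -exprS /= scaler_nat.
Qed.

(* Factor p as q (X + r)^a (X - r)^b with q nonzero at both points; comparing
   the two sides of the equation for q at r and -r determines a and b, and
   a + b = n leaves no room for q in degree n. *)
Lemma deriv_eq_sqr_solution n r lam p : r != 0 -> p != 0 -> (size p <= n.+1)%N ->
  ((r ^+ 2)%:P - 'X ^+ 2) * p^`() = (lam%:P - n%:R *: 'X) * p ->
  exists a b : nat, [/\ a%:R = n%:R / 2 + lam / (2 * r),
    b%:R = n%:R / 2 - lam / (2 * r)
    & exists c, p = c *: (('X - (- r)%:P) ^+ a * ('X - r%:P) ^+ b)].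
Proof.
move=> r0 p0 le_pn eq_p.
have [b [q1]] := multiplicity_XsubC p r; rewrite p0 /= => q1r Dp.
have [a [q]] := multiplicity_XsubC q1 (- r).
have -> /= : q1 != 0 by apply: contraNneq q1r => ->; rewrite root0.
move=> qNr Dq1; move: q1r Dp; rewrite {}Dq1 rootM negb_or => /andP[qr _] Dp.
set U := 'X - (- r)%:P in Dp *; set V := 'X - r%:P in Dp *.
have UVn0 : U ^+ a * V ^+ b != 0 by rewrite mulf_neq0 ?expf_neq0 ?polyXsubC_eq0.
have eq_q : - (U * V * q^`() + a%:R *: V * q + b%:R *: U * q)
    = (lam%:P - n%:R *: 'X) * q.
  apply: (mulIf UVn0); rewrite -[RHS]mulrA [q * _]mulrA -Dp -eq_p Dp.
  have -> : (r ^+ 2)%:P - 'X ^+ 2 = - (U * V).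
    by rewrite /U /V polyCN rmorphXn /=; ring.
  have DU := mul_XsubC_deriv_exp (- r) a; have DV := mul_XsubC_deriv_exp r b.
  rewrite -!/U -!/V -!mul_polyC in DU DV *; rewrite !derivM.
  transitivity (- (U * V * q^`() * U ^+ a * V ^+ b
     + (a%:R%:P * U ^+ a) * V * q * V ^+ b
     + (b%:R%:P * V ^+ b) * U * q * U ^+ a)); first by ring.
  by rewrite -DU -DV; ring.
have r20 : 2 * r != 0 by rewrite mulf_neq0 // pnatr_eq0.
(* At [- r] the terms of [eq_q] containing [U] vanish and [V] takes the value -2r; at [r] the roles
   are exchanged. *)
have Da : a%:R = n%:R / 2 + lam / (2 * r).
  have /(congr1 (horner^~ (- r))) := eq_q; rewrite !hornerE.
  move=> Er; have : (a%:R * (2 * r) - (lam + n%:R * r)) * q.[- r] = 0.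
    by move/eqP: Er; rewrite -subr_eq0 => /eqP <-; ring.
  move/eqP; rewrite mulf_eq0 -[q.[_] == 0]/(root q _) (negPf qNr) orbF subr_eq0 => /eqP Ea.
  by rewrite -(mulfK r20 a%:R) Ea; field.
have Db : b%:R = n%:R / 2 - lam / (2 * r).
  have /(congr1 (horner^~ r)) := eq_q; rewrite !hornerE.
  move=> Er; have : (b%:R * (2 * r) - (n%:R * r - lam)) * q.[r] = 0.
    by move/eqP: Er; rewrite eq_sym -subr_eq0 => /eqP <-; ring.
  move/eqP; rewrite mulf_eq0 -[q.[_] == 0]/(root q _) (negPf qr) orbF subr_eq0 => /eqP Eb.
  by rewrite -(mulfK r20 b%:R) Eb; field.
exists a, b; split=> //.
have Dn : (a + b)%N = n.
  by apply/eqP; rewrite -(eqr_nat F) natrD Da Db; apply/eqP; field.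
have q0 : q != 0 by apply: contraNneq qr => ->; rewrite root0.
have : (size q <= 1)%N.
  move: le_pn; rewrite Dp -mulrA !size_mul ?expf_neq0 ?polyXsubC_eq0 //.
  by rewrite !size_exp_XsubC -Dn addnS !addSn addnS /= -[X in (_ <= X)%N]add1n leq_add2r.
by move/size1_polyC => Dq; exists q`_0; rewrite Dp -mulrA {1}Dq mul_polyC.
Qed.

(** Here the two roots merge into a double root at 0. After the exact power of X is divided out, the
    value at 0 forces [lam = 0]; then one more X cancels, and the value at 0 of what remains gives
    [b = n]. *)
Lemma deriv_eq_0_solution n lam p : p != 0 -> (size p <= n.+1)%N ->
  - 'X ^+ 2 * p^`() = (lam%:P - n%:R *: 'X) * p -> exists c, p = c *: 'X^n.
Proof.
move=> p0 le_pn eq_p.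
have [b [q]] := multiplicity_XsubC p 0; rewrite p0 subr0 /= => q0 Dp.
have eq_q : - ('X ^+ 2 * q^`() + b%:R *: 'X * q) = (lam%:P - n%:R *: 'X) * q.
  have Xb0 : ('X : {poly F}) ^+ b != 0 by rewrite expf_neq0 ?polyX_eq0.
  apply: (mulIf Xb0); rewrite -[RHS]mulrA -Dp -eq_p Dp derivM.
  have DX := mul_XsubC_deriv_exp 0 b; rewrite subr0 -mul_polyC in DX.
  rewrite -mul_polyC.
  transitivity (- ('X^2 * q^`() * 'X ^+ b + 'X * q * (b%:R%:P * 'X ^+ b))).
    by ring.
  by rewrite -DX; ring.
have lam0 : lam = 0.
  have /(congr1 (horner^~ 0)) := eq_q; rewrite !hornerE /= => /esym/eqP.
  rewrite !(expr0n, mulr0, mul0r, addr0, subr0, oppr0) /=.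
  by rewrite mulf_eq0 -[q.[_] == 0]/(root q _) (negPf q0) orbF => /eqP.
have eq_q' : 'X * q^`() + b%:R *: q = n%:R *: q.
  have X0 : ('X : {poly F}) != 0 by rewrite polyX_eq0.
  apply: (mulfI X0); apply: oppr_inj.
  rewrite -mul_polyC -[in RHS]mul_polyC.
  transitivity ((lam%:P - n%:R *: 'X) * q).
    by rewrite -eq_q -mul_polyC; ring.
  by rewrite lam0 polyC0 -mul_polyC; ring.
have Dn : b = n.
  have /(congr1 (horner^~ 0)) := eq_q'; rewrite !hornerE => /(mulIf q0) /eqP.
  by rewrite eqr_nat => /eqP.
have : (size q <= 1)%N.
  have q_n0 : q != 0 by apply: contraNneq q0 => ->; rewrite root0.
  by move: le_pn; rewrite Dp size_mul ?expf_neq0 ?polyX_eq0 //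
    size_polyXn -Dn addnS /= -[X in (_ <= X)%N]add1n leq_add2r.
by move/size1_polyC => Dq; exists q`_0; rewrite Dp {1}Dq mul_polyC Dn.
Qed.

End LinearODE.

(** * Ladder operators and polynomial symbols in the Dicke basis *)

Section SpinSymbols.
Variables (R : realType) (n : nat).
Local Notation C := R[i].
Local Notation M := 'M[C]_n.+1.

Definition coherent_weight (k : nat) : C := sqrtC ('C(n, k))%:R.
Local Notation w := coherent_weight.

(** With k = j + m the radicand (j - m)(j + m + 1) is a natural number; the same coefficient serves
    J+ from k to k + 1 and J- back. *)
Definition ladder (k : nat) : C := sqrtC (k.+1 * (n - k))%:R.

Lemma coherent_weight_neq0 k : (k <= n)%N -> w k != 0.
Proof. by move=> le_kn; rewrite sqrtC_eq0 pnatr_eq0 -lt0n bin_gt0. Qed.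

Lemma coherent_weight_sqr k : w k * w k = 'C(n, k)%:R.
Proof. by rewrite -expr2 sqrtCK. Qed.

Lemma conj_coherent_weight k : (w k)^* = w k.
Proof. by apply: geC0_conj; rewrite sqrtC_ge0 ler0n. Qed.

(** Since (k + 1) C(n, k + 1) = (n - k) C(n, k), the product of radicands is a binomial coefficient
    times a perfect square. This and the next identity remove the square roots from the action of J-
    and J+ on symbols. *)
Lemma coherent_weight_ladder k : w k * ladder k = k.+1%:R * w k.+1.
Proof.
rewrite /w /ladder -sqrtCM ?nnegrE ?ler0n // -natrM mulnCA [('C(_, _) * _)%N]mulnC.
rewrite -mul_bin_left mulnA natrM sqrtCM ?nnegrE ?ler0n //.
by rewrite natrM -expr2 sqrCK ?ler0n.
Qed.

Lemma coherent_weightS_ladder k : w k.+1 * ladder k = (n - k)%:R * w k.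
Proof.
rewrite /w /ladder -sqrtCM ?nnegrE ?ler0n // -natrM mulnA [('C(_, _) * _)%N]mulnC.
rewrite mul_bin_left mulnAC natrM sqrtCM ?nnegrE ?ler0n //.
by rewrite natrM -expr2 sqrCK ?ler0n.
Qed.

Lemma ladder_neq0 k : (k < n)%N -> ladder k != 0.
Proof. by move=> lt_kn; rewrite sqrtC_eq0 pnatr_eq0 muln_eq0 /= subn_eq0 -ltnNge. Qed.

Lemma JplusE (a b : 'I_n.+1) :
  Jplus R n a b = if (a == b.+1 :> nat) then ladder b else 0.
Proof.
rewrite mxE; case: ifP => // _; congr sqrtC.
have le_bn : (b <= n)%N by rewrite -ltnS.
by rewrite /mag /spin natrM natrB // -natr1; field.
Qed.

Lemma JminusE (a b : 'I_n.+1) :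
  Jminus R n a b = if (a.+1 == b :> nat) then ladder a else 0.
Proof.
rewrite mxE; case: ifP => // /eqP ab; congr sqrtC.
have le_an : (a <= n)%N by rewrite -ltnS.
by rewrite /mag /spin -ab natrM natrB // -natr1; field.
Qed.

Lemma trmx_Jminus : (Jminus R n)^T = Jplus R n.
Proof. by apply/matrixP => a b; rewrite mxE JminusE JplusE eq_sym. Qed.

Lemma trmx_Jplus : (Jplus R n)^T = Jminus R n.
Proof. by rewrite -trmx_Jminus trmxK. Qed.

Lemma inordK_le k : (k <= n)%N -> (inord k : 'I_n.+1) = k :> nat.
Proof. by move=> le_kn; rewrite inordK. Qed.

Lemma Jplus_mulS m (X : 'M[C]_(n.+1, m)) k l : (k < n)%N ->
  (Jplus R n *m X) (inord k.+1) l = ladder k * X (inord k) l.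
Proof.
move=> lt_kn; have le_kn := ltnW lt_kn.
rewrite mxE (bigD1 (inord k)) //= JplusE !inordK_le // eqxx big1 ?addr0 // => i.
rewrite JplusE inordK_le // eqSS eq_sym -val_eqE /= inordK_le // => /negPf->.
by rewrite mul0r.
Qed.

Lemma Jplus_mul0 m (X : 'M[C]_(n.+1, m)) l :
  (Jplus R n *m X) (inord 0) l = 0.
Proof. by rewrite mxE big1 // => i _; rewrite JplusE inordK_le //= mul0r. Qed.

Lemma Jminus_mul m (X : 'M[C]_(n.+1, m)) k l : (k < n)%N ->
  (Jminus R n *m X) (inord k) l = ladder k * X (inord k.+1) l.
Proof.
move=> lt_kn; have le_kn := ltnW lt_kn.
rewrite mxE (bigD1 (inord k.+1)) //= JminusE !inordK_le // eqxx big1 ?addr0 // => i.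
rewrite JminusE inordK_le // eq_sym -val_eqE /= inordK_le // => /negPf->.
by rewrite mul0r.
Qed.

Lemma Jminus_mul_max m (X : 'M[C]_(n.+1, m)) l :
  (Jminus R n *m X) (inord n) l = 0.
Proof.
rewrite mxE big1 // => i _; rewrite JminusE inordK_le // gtn_eqF ?mul0r //.
Qed.

(** Its value at the conjugate of [xi] is the pairing of the coherent state at [xi] with [x];
    polynomial methods thus apply to Wick symbols. *)
Definition col_symbol (x : 'cV[C]_n.+1) : {poly C} :=
  \poly_(k < n.+1) (w k * x (inord k) 0).

(* No bound on k is needed because w k = 0 beyond n. *)
Lemma coef_col_symbol x k : (col_symbol x)`_k = w k * x (inord k) 0.
Proof.
rewrite coef_poly; case: ltnP => // lt_nk.
by rewrite /w bin_small // sqrtC0 mul0r.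
Qed.

Lemma col_symbol0 : col_symbol 0 = 0.
Proof. by apply/polyP => k; rewrite coef_col_symbol mxE coef0 mulr0. Qed.

Lemma col_symbol_eq0 x : col_symbol x = 0 -> x = 0.
Proof.
move=> x0; apply/matrixP => i j; rewrite ord1 mxE.
have le_in : (i <= n)%N by rewrite -ltnS.
apply: (mulfI (coherent_weight_neq0 _ le_in)); rewrite mulr0.
by rewrite -[i in x i 0]inord_val -coef_col_symbol x0 coef0.
Qed.

Lemma col_symbolD x y : col_symbol (x + y) = col_symbol x + col_symbol y.
Proof.
by apply/polyP => k; rewrite coefD !coef_col_symbol mxE mulrDr.
Qed.

Lemma col_symbolZ a x : col_symbol (a *: x) = a *: col_symbol x.
Proof. by apply/polyP => k; rewrite coefZ !coef_col_symbol mxE mulrCA. Qed.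

Lemma col_symbol_Jminus x : col_symbol (Jminus R n *m x) = (col_symbol x)^`().
Proof.
apply/polyP => k; rewrite coef_deriv !coef_col_symbol.
case: (ltngtP k n) => [lt_kn|lt_nk|->].
- by rewrite Jminus_mul // mulrA coherent_weight_ladder -mulrA mulr_natl.
- by rewrite /w !bin_small // ?leqW // sqrtC0 !mul0r mul0rn.
- by rewrite Jminus_mul_max mulr0 /w bin_small // sqrtC0 mul0r mul0rn.
Qed.

Lemma col_symbol_Jplus x :
  col_symbol (Jplus R n *m x)
    = 'X * (n%:R *: col_symbol x - 'X * (col_symbol x)^`()).
Proof.
apply/polyP => -[|k]; rewrite coefXM coef_col_symbol /=.
  by rewrite Jplus_mul0 mulr0.
rewrite coefB coefZ coefXM coef_col_symbol.
have -> : (if k == 0 then 0 else (col_symbol x)^`()`_k.-1)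
    = k%:R * (w k * x (inord k) 0).
  case: k => [|k] /=; first by rewrite mul0r.
  by rewrite coef_deriv coef_col_symbol mulr_natl.
rewrite -mulrBl mulrA; case: (leqP n k) => [|lt_kn]; last first.
  by rewrite Jplus_mulS // mulrA coherent_weightS_ladder natrB ?mulrA // ltnW.
(* At k = n the factor n - k vanishes, so J+ creates no term of degree n + 1. *)
rewrite leq_eqVlt => /predU1P[<-|lt_nk].
  by rewrite subrr !mul0r /w bin_small // sqrtC0 mul0r.
by rewrite /w !bin_small // ?leqW // sqrtC0 !(mulr0, mul0r).
Qed.

Lemma size_col_symbol x : (size (col_symbol x) <= n.+1)%N.
Proof. exact: size_poly. Qed.

Lemma ladder_eigenvector r lam x : r != 0 -> x != 0 ->
  Jplus R n *m x + r ^+ 2 *: (Jminus R n *m x) = lam *: x ->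
  exists a b : nat, [/\ a%:R = n%:R / 2 + lam / (2 * r),
    b%:R = n%:R / 2 - lam / (2 * r)
    & exists c,
        col_symbol x = c *: (('X - (- r)%:P) ^+ a * ('X - r%:P) ^+ b)].
Proof.
move=> r0 x0 eq_x; apply: deriv_eq_sqr_solution => //.
- by apply: contraNneq x0 => /col_symbol_eq0->.
- exact: size_col_symbol.
have := congr1 col_symbol eq_x.
rewrite col_symbolD !col_symbolZ col_symbol_Jplus col_symbol_Jminus.
rewrite -!mul_polyC => E; rewrite [RHS]mulrBl -E; ring.
Qed.

Lemma Jplus_eigenvector lam x : x != 0 ->
  Jplus R n *m x = lam *: x -> exists c, col_symbol x = c *: 'X^n.
Proof.
move=> x0 eq_x; apply: (deriv_eq_0_solution _ n lam).
- by apply: contraNneq x0 => /col_symbol_eq0->.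
- exact: size_col_symbol.
have := congr1 col_symbol eq_x.
rewrite col_symbolZ col_symbol_Jplus -!mul_polyC => E; rewrite [RHS]mulrBl -E; ring.
Qed.

(** * Factorization and explicit form of Wick symbols *)

Lemma wickE (T : M) xi eta : wick T xi eta =
  \sum_(k < n.+1) \sum_(l < n.+1) w k * (xi^*) ^+ k * T k l * (w l * eta ^+ l).
Proof.
rewrite /wick mxE exchange_big /=; apply: eq_bigr => l _.
rewrite !mxE big_distrl /=; apply: eq_bigr => k _; rewrite !mxE.
by rewrite rmorphM rmorphXn /= conj_coherent_weight.
Qed.

Lemma wick_cols (T : M) xi eta : wick T xi eta =
  \sum_(l < n.+1) (col_symbol (col l T)).[xi^*] * (w l * eta ^+ l).
Proof.
rewrite wickE exchange_big; apply: eq_bigr => l _.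
rewrite horner_poly big_distrl; apply: eq_bigr => k _ /=.
by rewrite mxE inord_val; ring.
Qed.

Lemma wick_rows (T : M) xi eta : wick T xi eta =
  \sum_(k < n.+1) (col_symbol (col k T^T)).[eta] * (w k * (xi^*) ^+ k).
Proof.
rewrite wickE; apply: eq_bigr => k _.
rewrite horner_poly big_distrl; apply: eq_bigr => l _ /=.
by rewrite !mxE inord_val; ring.
Qed.

(** Separation of variables: the symbol is both F(conj xi) G(eta) and F(eta) H(conj xi). Setting
    conj xi = x0, where F does not vanish, shows that G is a multiple of F. *)
Lemma wick_factor (T : M) (F : {poly C}) x0 : F.[x0] != 0 ->
  (forall l, exists d, col_symbol (col l T) = d *: F) ->
  (forall k, exists d, col_symbol (col k T^T) = d *: F) ->
  exists c, forall xi eta, wick T xi eta = c * F.[xi^*] * F.[eta].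
Proof.
move=> Fx0 colT rowT.
have [d Dd] : exists d : 'I_n.+1 -> C, forall l, col_symbol (col l T) = d l *: F.
  exact: (@fin_all_exists _ _ (fun l d => col_symbol (col l T) = d *: F)).
have [e De] : exists e : 'I_n.+1 -> C, forall l, col_symbol (col l T^T) = e l *: F.
  exact: (@fin_all_exists _ _ (fun l d => col_symbol (col l T^T) = d *: F)).
pose G eta := \sum_(l < n.+1) d l * (w l * eta ^+ l).
pose H y := \sum_(k < n.+1) e k * (w k * y ^+ k).
have WG xi eta : wick T xi eta = F.[xi^*] * G eta.
  rewrite wick_cols big_distrr; apply: eq_bigr => l _ /=.
  by rewrite Dd hornerZ; ring.
have WH xi eta : wick T xi eta = F.[eta] * H (xi^*).
  rewrite wick_rows big_distrr; apply: eq_bigr => k _ /=.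
  by rewrite De hornerZ; ring.
exists (H x0 / F.[x0]) => xi eta; rewrite WG.
have -> : G eta = F.[eta] * H x0 / F.[x0].
  by have := WH (x0^*) eta; rewrite WG conjCK => <-; field.
by ring.
Qed.

Lemma wick_ladder_eigenmatrix (T : M) r lam : r != 0 -> T != 0 ->
  Jplus R n *m T + r ^+ 2 *: (Jminus R n *m T) = lam *: T ->
  T *m Jminus R n + r ^+ 2 *: (T *m Jplus R n) = lam *: T ->
  exists a b : nat, [/\ a%:R = n%:R / 2 + lam / (2 * r),
    b%:R = n%:R / 2 - lam / (2 * r)
    & exists c, forall xi eta, wick T xi eta =
        c * (xi^* + r) ^+ a * (xi^* - r) ^+ b * (eta + r) ^+ a * (eta - r) ^+ b].
Proof.
move=> r0 T0 colT rowT.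
have col_eq (X : M) l :
    Jplus R n *m X + r ^+ 2 *: (Jminus R n *m X) = lam *: X ->
    Jplus R n *m col l X + r ^+ 2 *: (Jminus R n *m col l X) = lam *: col l X.
  by move/(congr1 (col l)); rewrite linearD !linearZ /= !colE -!mulmxA.
(* Transposition exchanges J+ and J-, so the rows of [T] satisfy the same eigenvalue equation as its
   columns. *)
have rowT' : Jplus R n *m T^T + r ^+ 2 *: (Jminus R n *m T^T) = lam *: T^T.
  have := congr1 trmx rowT.
  by rewrite linearD !linearZ /= !trmx_mul trmx_Jminus trmx_Jplus.
(* One nonzero column supplies the exponents. They depend only on [n], [lam] and [r], so all nonzero
   columns and rows share the polynomial [F]. *)
have [l Tl0] : exists l, col l T != 0.
  apply/existsP; apply: contraNT T0; rewrite negb_exists => /forallP T0.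
  apply/eqP/matrixP => i l; have /negbNE/eqP/matrixP/(_ i 0) := T0 l.
  by rewrite !mxE.
have [a [b [Da Db _]]] := ladder_eigenvector _ _ _ r0 Tl0 (col_eq _ l colT).
exists a, b; split=> //.
pose F : {poly C} := ('X - (- r)%:P) ^+ a * ('X - r%:P) ^+ b.
have symbF x : Jplus R n *m x + r ^+ 2 *: (Jminus R n *m x) = lam *: x ->
    exists d, col_symbol x = d *: F.
  have [-> _|x0 eq_x] := eqVneq x 0; first by exists 0; rewrite col_symbol0 scale0r.
  have [a' [b' [Da' Db' [c Dc]]]] := ladder_eigenvector _ _ _ r0 x0 eq_x.
  have [Ea Eb] : a' = a /\ b' = b.
    by split; apply/eqP; rewrite -(eqr_nat C) ?Da' ?Db' ?Da ?Db.
  by exists c; rewrite Dc Ea Eb.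
have F0 : F.[0] != 0.
  by rewrite !hornerE mulf_neq0 ?expf_neq0 ?oppr_eq0 // opprK.
have [c Dc] := wick_factor _ _ _ F0 (fun l => symbF _ (col_eq _ l colT))
  (fun l => symbF _ (col_eq _ l rowT')).
by exists c => xi eta; rewrite Dc !hornerE !opprK.
Qed.

Lemma wick_Jplus_eigenmatrix (T : M) lam :
  Jplus R n *m T = lam *: T -> T *m Jminus R n = lam *: T ->
  exists c, forall xi eta, wick T xi eta = c * (xi^*) ^+ n * eta ^+ n.
Proof.
move=> colT rowT.
have symbF (X : M) l : Jplus R n *m X = lam *: X ->
    exists d, col_symbol (col l X) = d *: 'X^n.
  have [-> _|x0] := eqVneq (col l X) 0.
    by exists 0; rewrite col_symbol0 scale0r.
  move/(congr1 (col l)); rewrite linearZ /= !colE -mulmxA.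
  by rewrite -colE; apply: Jplus_eigenvector.
have rowT' : Jplus R n *m T^T = lam *: T^T.
  by have := congr1 trmx rowT; rewrite linearZ /= trmx_mul trmx_Jminus.
have F1 : ('X^n : {poly C}).[1] != 0 by rewrite hornerXn expr1n oner_eq0.
have [c Dc] := wick_factor _ _ _ F1 (fun l => symbF _ l colT)
  (fun l => symbF _ l rowT').
by exists c => xi eta; rewrite Dc !hornerXn.
Qed.

(* The relation, shifting both indices by one, pushes every entry above the
   diagonal into the last column, where it vanishes. *)
Lemma intertwiner_entries (T : M) q : Jplus R n *m T = q *: (T *m Jplus R n) ->
  (forall k l, (k < l <= n)%N -> T (inord k) (inord l) = 0) /\
  (forall k, (k < n)%N ->
     T (inord k) (inord k) = q * T (inord k.+1) (inord k.+1)).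
Proof.
move=> eq_T.
have TJ k l : (l < n)%N ->
    (T *m Jplus R n) (inord k) (inord l) = ladder l * T (inord k) (inord l.+1).
  move=> lt_ln; rewrite -[T *m _]trmxK trmx_mul trmx_Jplus mxE Jminus_mul //.
  by rewrite mxE.
have TJn k : (T *m Jplus R n) (inord k) (inord n) = 0.
  by rewrite -[T *m _]trmxK trmx_mul trmx_Jplus mxE Jminus_mul_max.
have JT k l : (k < n)%N -> T (inord k) (inord l)
    = q * (T *m Jplus R n) (inord k.+1) (inord l) / ladder k.
  move=> lt_kn; have := congr1 (fun X : M => X (inord k.+1) (inord l)) eq_T.
  rewrite Jplus_mulS // mxE => <-.
  by rewrite [ladder k * _]mulrC mulfK ?ladder_neq0.
split=> [k l /andP[lt_kl le_ln]|k lt_kn]; last first.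
  by rewrite JT // TJ // mulrCA mulrAC divff ?mul1r ?ladder_neq0.
(* Induction on the distance [m] from column [l] to the last column. *)
have [m Dm] : exists m, (l + m = n)%N by exists (n - l)%N; rewrite subnKC.
elim: m => [|m IHm] in k l lt_kl le_ln Dm *.
  rewrite addn0 in Dm; rewrite {l}Dm in lt_kl le_ln *.
  by rewrite JT // TJn mulr0 mul0r.
have lt_ln : (l < n)%N by rewrite -Dm -addSnnS leq_addr.
rewrite JT ?(leq_trans lt_kl) // TJ // IHm ?ltnS ?addSnnS //.
by rewrite !(mulr0, mul0r).
Qed.

(** The relation and its transposed companion kill both off-diagonal triangles. Descending from the
    last diagonal entry c, the entry at k is c q^(n - k); the squared weights are binomial
    coefficients, so the symbol is a binomial expansion. *)
Lemma wick_intertwiner (T : M) q :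
  Jplus R n *m T = q *: (T *m Jplus R n) ->
  T *m Jminus R n = q *: (Jminus R n *m T) ->
  exists c, forall xi eta, wick T xi eta = c * (xi^* * eta + q) ^+ n.
Proof.
move=> colT rowT; have [Tup Tdiag] := intertwiner_entries _ _ colT.
have rowT' : Jplus R n *m T^T = q *: (T^T *m Jplus R n).
  have := congr1 trmx rowT.
  by rewrite linearZ /= !trmx_mul trmx_Jminus.
have [Tdown _] := intertwiner_entries _ _ rowT'.
have Toff (k l : 'I_n.+1) : l != k -> T k l = 0.
  rewrite -val_eqE neq_ltn /= => /orP[lt_lk|lt_kl].
    have := Tdown l k; rewrite mxE !inord_val; apply.
    by rewrite lt_lk -ltnS ltn_ord.
  by rewrite -[k]inord_val -[l]inord_val Tup // lt_kl -ltnS ltn_ord.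
pose c := T (inord n) (inord n).
have Tkk m : (m <= n)%N -> T (inord (n - m)) (inord (n - m)) = c * q ^+ m.
  elim: m => [|m IHm] lt_mn; first by rewrite subn0 mulr1.
  rewrite Tdiag; last by rewrite ltn_subrL (leq_ltn_trans _ lt_mn).
  by rewrite -subSn // subSS IHm ?(ltnW lt_mn) // exprS; ring.
exists c => xi eta; rewrite wickE addrC exprDn big_distrr /=.
apply: eq_bigr => k _; have le_kn : (k <= n)%N by rewrite -ltnS.
rewrite (bigD1 k) //= big1 ?addr0 => [|l lk]; last by rewrite Toff // mulr0 mul0r.
have := Tkk _ (leq_subr k n); rewrite subKn // inord_val => ->.
rewrite exprMn -mulr_natr -coherent_weight_sqr; ring.
Qed.

End SpinSymbols.

(** * The two conditions in terms of J+ and J- *)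

Section LadderForm.
Variables (R : realType) (n : nat) (T : 'M[R[i]]_n.+1).
Local Notation C := R[i].
Local Notation Jp := (Jplus R n).
Local Notation Jm := (Jminus R n).

Lemma ladder_form_y (s a : C) :
  ('i * s) *: commutator T (Jx R n) + anticommutator T (Jy R n - a%:M) = 0 ->
  (s + 1) *: (Jp *m T - T *m Jm) + (s - 1) *: (Jm *m T - T *m Jp)
    = (4 * 'i * a) *: T.
Proof.
rewrite /commutator /anticommutator /Jx /Jy.
rewrite mulmxBl mulmxBr -!scalemxAl -!scalemxAr.
rewrite !(mulmxBl, mulmxBr, mulmxDl, mulmxDr) mul_scalar_mx mul_mx_scalar.
(* Only these four products occur; once they are generalized, the identity can be checked entrywise
   in the commutative field. *)
move: (T *m Jp) (Jp *m T) (T *m Jm) (Jm *m T) => A B D E.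
move=> /matrixP eq_T; apply/matrixP => k l; have := eq_T k l; rewrite !mxE.
have i0 : 'i != 0 :> C by rewrite neq0Ci.
have i2 : 'i * 'i = -1 :> C by rewrite -expr2 sqrCi.
move=> E0; apply/eqP; rewrite -subr_eq0; apply/eqP.
(* The conclusion is 2i times the hypothesis, which clears the factor 1/(2i) of [Jy]. *)
transitivity (2 * 'i * 0 : C); last by rewrite mulr0.
rewrite -[in RHS]E0 invfM.
have -> : 'i^-1 = - 'i :> C by rewrite invCi.
by field: i2.
Qed.

Lemma ladder_form_x (t b : C) :
  ('i * t) *: commutator T (Jy R n) + anticommutator T (Jx R n - b%:M) = 0 ->
  (1 - t) *: (Jp *m T + T *m Jm) + (1 + t) *: (Jm *m T + T *m Jp)
    = (4 * b) *: T.
Proof.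
rewrite /commutator /anticommutator /Jx /Jy.
rewrite mulmxBl mulmxBr -!scalemxAl -!scalemxAr.
rewrite !(mulmxBl, mulmxBr, mulmxDl, mulmxDr) mul_scalar_mx mul_mx_scalar.
move: (T *m Jp) (Jp *m T) (T *m Jm) (Jm *m T) => A B D E.
move=> /matrixP eq_T; apply/matrixP => k l; have := eq_T k l; rewrite !mxE.
have i2 : 'i * 'i = -1 :> C by rewrite -expr2 sqrCi.
move=> E0; apply/eqP; rewrite -subr_eq0; apply/eqP.
transitivity (2 * 0 : C); last by rewrite mulr0.
rewrite -[in RHS]E0 invfM.
have -> : 'i^-1 = - 'i :> C by rewrite invCi.
by field: i2.
Qed.

End LadderForm.

(** * Assembly of the two cases *)

Theorem mainTheorem3 (R : realType) (n : nat) (rho T : 'M[R[i]]_n.+1) (s t : R) :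
  (0 < n)%N -> density rho -> is_psd_sqrt rho T ->
  s <> -1 -> t <> 1 ->
  ('i * s%:C%C) *: commutator T (Jx R n)
    + anticommutator T (Jy R n - (\tr (rho *m Jy R n))%:M) = 0 ->
  ('i * t%:C%C) *: commutator T (Jy R n)
    + anticommutator T (Jx R n - (\tr (rho *m Jx R n))%:M) = 0 ->
  let j : R[i] := spin R n in
  let u : R[i] := 4 * \tr (rho *m Jy R n) in
  let v : R[i] := 4 * \tr (rho *m Jx R n) in
  let s' : R[i] := ((s - 1) / (s + 1))%:C%C in
  let v' : R[i] := v / (1 - t)%:C%C in
  (s = - t -> u = 0 -> v = 0 ->
     exists c : R[i], forall xi eta : R[i],
       wick T xi eta = c * (xi^* * eta + s') ^+ n)
  /\
  (s * t = -1 -> u = 0 ->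
     (s' <> 0 -> forall r : R[i], r ^+ 2 = s' ->
        exists a b : nat,
          [/\ a%:R = j + v' / (4 * r), b%:R = j - v' / (4 * r)
            & exists c : R[i], forall xi eta : R[i],
                wick T xi eta =
                  c * (xi^* + r) ^+ a * (xi^* - r) ^+ b
                    * (eta + r) ^+ a * (eta - r) ^+ b])
     /\
     (s' = 0 ->
        exists c : R[i], forall xi eta : R[i],
          wick T xi eta = c * (xi^*) ^+ n * eta ^+ n)).
Proof.
move=> _ [_ tr_rho] [_ sqrT] s1 t1 /ladder_form_y eq_y /ladder_form_x eq_x j u v s' v'.
have T0 : T != 0.
  apply/eqP => T0; move: tr_rho; rewrite -sqrT T0 mul0mx linear0 => /esym/eqP.
  by rewrite oner_eq0.
have s1' : s%:C%C + 1 != 0 :> R[i].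
  by rewrite -(rmorph1 (real_complex R)) -rmorphD fmorph_eq0 addr_eq0; apply/eqP.
have t1' : 1 - t%:C%C != 0 :> R[i].
  rewrite -(rmorph1 (real_complex R)) -rmorphB fmorph_eq0 subr_eq0 eq_sym.
  exact/eqP.
have Ds' : s' = (s%:C%C - 1) / (s%:C%C + 1).
  by rewrite /s' fmorph_div rmorphB rmorphD rmorph1.
have Dv' : v' = v / (1 - t%:C%C) by rewrite /v' rmorphB rmorph1.
have {eq_y}eq_y : u = 0 ->
    Jplus R n *m T + s' *: (Jminus R n *m T) = T *m Jminus R n + s' *: (T *m Jplus R n).
  move=> u0; move: eq_y; rewrite mulrAC -/u u0 mul0r scale0r => eq_y.
  apply: (scalerI s1'); apply/eqP; rewrite -subr_eq0 -eq_y; apply/eqP.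
  apply/matrixP => k l; rewrite Ds' !mxE; by field.
(* The ratio is kept as a parameter [t']: it equals -s' when s = -t, and s' when st = -1. *)
have {eq_x}eq_x t' : (1 + t%:C%C) / (1 - t%:C%C) = t' ->
    Jplus R n *m T + T *m Jminus R n + t' *: (Jminus R n *m T + T *m Jplus R n)
      = v' *: T.
  move=> <-; apply: (scalerI t1'); rewrite scalerA Dv' mulrCA divff // mulr1 -eq_x.
  by rewrite scalerDr scalerA mulrCA divff // mulr1.
(* In each case one condition gives the sum of two matrices and the other their equality. *)
have half (x y z : 'M[R[i]]_n.+1) : x + y = z -> x = y -> x = 2^-1 *: z.
  by move=> <- <-; rewrite -mulr2n -[x *+ 2]scaler_nat scalerA mulVf ?scale1r // pnatr_eq0.
split=> [st u0 v0|st u0].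
  have {}eq_x : Jplus R n *m T - s' *: (T *m Jplus R n)
      + (T *m Jminus R n - s' *: (Jminus R n *m T)) = 0.
    have := eq_x (- s'); rewrite Dv' v0 mul0r scale0r => <-.
      by rewrite scaleNr scalerDr opprD addrACA [in RHS](addrC (- (s' *: _))).
    by rewrite Ds' st rmorphN -opprD mulNr opprK [- _ + 1]addrC [_ + 1]addrC.
  have {}eq_y : Jplus R n *m T - s' *: (T *m Jplus R n)
      = T *m Jminus R n - s' *: (Jminus R n *m T).
    by apply/eqP; rewrite subr_eq addrAC eq_sym subr_eq eq_y.
  have := half _ _ _ eq_x eq_y; rewrite scaler0 => X0.
  by apply: wick_intertwiner; apply/eqP; rewrite -subr_eq0 -?eq_y X0.
have t's' : (1 + t%:C%C) / (1 - t%:C%C) = s'.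
  have st' : s%:C%C * t%:C%C = -1 :> R[i] by rewrite -rmorphM st rmorphN1.
  by rewrite Ds'; apply/eqP; rewrite eqr_div //; apply/eqP; ring: st'.
have {t's'}eq_x := eq_x _ t's'; have {}eq_y := eq_y u0.
have {}eq_x : Jplus R n *m T + s' *: (Jminus R n *m T)
    + (T *m Jminus R n + s' *: (T *m Jplus R n)) = v' *: T.
  by rewrite -eq_x scalerDr addrACA.
(* Both expressions equal (v'/2) T; with lam = v'/2, the exponents n/2 ± lam/(2r) become j ±
   v'/(4r). *)
have colT := half _ _ _ eq_x eq_y.
have rowT := colT; rewrite eq_y in rowT.
rewrite scalerA in colT rowT.
split=> [s'0 r r2|s'0].
  have r0 : r != 0 by apply: contra_not_neq s'0 => r0; rewrite -r2 r0 expr0n.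
  rewrite -r2 in colT rowT.
  have [a [b [Da Db Wab]]] := wick_ladder_eigenmatrix _ _ _ _ _ r0 T0 colT rowT.
  by exists a, b; split=> //; rewrite ?Da ?Db /j /spin; field.
rewrite s'0 !scale0r !addr0 in colT rowT.
exact: wick_Jplus_eigenmatrix colT rowT.
Qed.
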